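(* The forms $x^2+3y^2+14z^2$ and $2x^2+3y^2+7z^2$ are both $(14,7)$-universal; that is, for every $n\in\mathbb{N}$, the integer $14n+7$ can be written as $x^2+3y^2+14z^2$ with $x,y,z\in\mathbb{Z}$, and also as $2x^2+3y^2+7z^2$ with $x,y,z\in\mathbb{Z}$.
   Context: Let $d$ be a positive integer and $r\in\{0,\ldots,d-1\}$. For integers $a,b,c$, the form $ax^2+by^2+cz^2$ is called $(d,r)$-universal if every integer $dn+r$ with $n\in\mathbb{N}=\{0,1,2,\ldots\}$ can be written as $ax^2+by^2+cz^2$ with $x,y,z\in\mathbb{Z}$. *)

(* Defs.v *)
From Stdlib Require Import ZArith.

Local Open Scope Z_scope.

(* The form [a x^2 + b y^2 + c z^2] is (d,r)-universal; meant for [0 <= r < d]. *)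
Definition universal (d r a b c : Z) : Prop :=
  forall n : nat, exists x y z : Z,
    d * Z.of_nat n + r = a * x ^ 2 + b * y ^ 2 + c * z ^ 2.

(* Main.v *)
Require Import Defs.
From Stdlib Require Import ZArith.
From mathcomp Require Import all_boot all_algebra.
From mathcomp Require Import zify ssrZ.

(** Multiplying by 7 reduces both forms to the claim that every odd [N > 0] is
    [x^2 + 2 y^2 + 3 z^2], and this follows from a representation of [6 N] as a
    sum of three squares after adjusting signs mod 3.  With [3 N = 2 k + 1] and
    [tri i = 2 i^2 + i], such a representation exists as soon as [R k > 0],
    where [R k] is the number of [(i, j, l)] with
    [tri i + tri j + 2 tri l = k].

    Let [T k] be the number of [(x, y, z)] with [x, y > 0], [z >= 0] and
    [x (y + z) + 2 y z = 2 k + 1] (essentially a class number).  It is positive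
    because of [(2 k + 1, 1, 0)], and [R = T] by induction, since both satisfy
    [\sum_f F (k - f^2) = sigma (2 k + 1)], the sum being over all integers.

    - For [R], the left-hand side counts the solutions of
      [tri i + tri j + tri p + tri q = k].  Fourth powers [V] of the series
      [\sum_i X^(tri i)] are characterised by
      [\sum_i (k - 5 tri i) V (k - tri i) = 0]; that [sigma (2 k + 1)] satisfies
      the same recurrence is an identity for sums over
      [M = x^2 + 4 d e], proved with Zagier's involution.
    - For [T], this is a Kronecker-Hurwitz class number relation; it is proved by
      explicit bijections that mimic telescoping of partial fractions. *)

Set Implicit Arguments.
Unset Strict Implicit.
Unset Printing Implicit Defensive.

Import GRing.Theory.

Local Open Scope Z_scope.
#[local] Delimit Scope Z_scope with Z.

#[local] Arguments Z.mul : simpl never.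
#[local] Arguments Z.add : simpl never.
#[local] Arguments Z.sub : simpl never.

(** * Finite counting *)

Lemma reindex_seq (V : nmodType) (T U : eqType) (s : seq T) (t : seq U)
    (P : pred T) (Q : pred U) (f : T -> U) (g : U -> T) (F : U -> V) :
  uniq s -> uniq t ->
  (forall x, x \in s -> P x -> [/\ f x \in t, Q (f x) & g (f x) = x]) ->
  (forall y, y \in t -> Q y -> [/\ g y \in s, P (g y) & f (g y) = y]) ->
  (\sum_(y <- t | Q y) F y = \sum_(x <- s | P x) F (f x))%R.
Proof.
move=> us ut fP gP.
rewrite -[LHS]big_filter -[RHS]big_filter -(big_map f xpredT).
apply/perm_big/uniq_perm; first exact: filter_uniq.
  rewrite map_inj_in_uniq ?filter_uniq // => x y.
  rewrite !mem_filter => /andP[Px xs] /andP[Py ys] E.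
  by have [_ _ <-] := fP x xs Px; have [_ _ <-] := fP y ys Py; rewrite E.
move=> y; rewrite mem_filter; apply/andP/mapP => [[Qy yt]|[x]].
  have [gs Pg <-] := gP y yt Qy.
  by exists (g y) => //; rewrite mem_filter Pg.
by rewrite mem_filter => /andP[Px xs] ->; have [-> ->] := fP x xs Px.
Qed.

(** All solution sets below are finite, so each is counted inside a symmetric box with [L] large
    enough to contain it. *)
Definition box (L : Z) : seq Z :=
  [seq Z.of_nat i - L | i <- iota 0 (Z.to_nat (2 * L + 1))].

Lemma mem_box L x : (x \in box L) = (- L <=? x) && (x <=? L).
Proof.
apply/mapP/idP => [[i]|h]; first by rewrite mem_iota; lia.
by exists (Z.to_nat (x + L)); rewrite ?mem_iota; lia.
Qed.

Lemma box_uniq L : uniq (box L).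
Proof. by rewrite map_inj_uniq ?iota_uniq // => i j; lia. Qed.

Definition box2 L : seq (Z * Z) := [seq (x, y) | x <- box L, y <- box L].
Definition box3 L : seq (Z * Z * Z) := [seq (x, y) | x <- box2 L, y <- box L].
Definition box4 L : seq (Z * Z * Z * Z) :=
  [seq (x, y) | x <- box3 L, y <- box L].

Lemma mem_pairs (T U : eqType) (s : seq T) (t : seq U) x y :
  ((x, y) \in [seq (x, y) | x <- s, y <- t]) = (x \in s) && (y \in t).
Proof.
by apply/allpairsP/andP => [[[a b] [/= ? ? [-> ->]]]|[? ?]] //; exists (x, y).
Qed.

Lemma pairs_uniq (T U : eqType) (s : seq T) (t : seq U) :
  uniq s -> uniq t -> uniq [seq (x, y) | x <- s, y <- t].
Proof. by move=> us ut; apply: allpairs_uniq => // -[a b] [c d] _ _. Qed.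

Lemma box2_uniq L : uniq (box2 L).
Proof. by rewrite pairs_uniq ?box_uniq. Qed.
Lemma box3_uniq L : uniq (box3 L).
Proof. by rewrite pairs_uniq ?box2_uniq ?box_uniq. Qed.
Lemma box4_uniq L : uniq (box4 L).
Proof. by rewrite pairs_uniq ?box3_uniq ?box_uniq. Qed.

Definition mem_boxes := (mem_pairs, mem_box).

Definition Zcard (T : eqType) (s : seq T) (P : pred T) : Z :=
  (\sum_(v <- s | P v) 1)%R.

Lemma Zcard_bij (T U : eqType) (s : seq T) (t : seq U)
    (P : pred T) (Q : pred U) (f : T -> U) (g : U -> T) :
  uniq s -> uniq t ->
  (forall x, x \in s -> P x -> [/\ f x \in t, Q (f x) & g (f x) = x]) ->
  (forall y, y \in t -> Q y -> [/\ g y \in s, P (g y) & f (g y) = y]) ->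
  Zcard t Q = Zcard s P.
Proof. by move=> us ut fP gP; rewrite /Zcard (reindex_seq _ us ut fP gP). Qed.

Lemma Zcard_split (T : eqType) (s : seq T) (Q P : pred T) :
  Zcard s P = Zcard s (predI P Q) + Zcard s (predI P (predC Q)).
Proof. by rewrite /Zcard (bigID Q). Qed.

Lemma eq_Zcard (T : eqType) (s : seq T) (P Q : pred T) :
  P =1 Q -> Zcard s P = Zcard s Q.
Proof. exact: eq_bigl. Qed.

Lemma abs_le_sqr x : Z.abs x <= x * x.
Proof. by case: (Z.abs_spec x) => -[? ->]; nia. Qed.

Ltac Zify.zify_post_hook ::= Z.to_euclidean_division_equations.


(** * The class number relation *)

Definition oddZ x := (x mod 2 =? 1).

Lemma oddZE x : oddZ x -> exists y, x = 2 * y + 1.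
Proof. by move=> h; exists (x / 2); rewrite /oddZ in h; lia. Qed.

(* [cone m] counts [\sum_f T (k - f^2)] for [m = 2 k + 1]; [x] and [y + z] are
   automatically odd when [m] is. *)
Definition cone m (v : Z * Z * Z * Z) := let: (x, y, z, f) := v in
  [&& 0 <? x, 0 <? y, 0 <=? z & m =? x * (y + z) + 2 * y * z + 2 * f * f].

(* With [s = y + z], [t = y - z] and [e = 2 f - t], the equation of [cone] reads
   [2 m = s^2 + e^2 + 2 s x + 2 t e].  For [e > 0] the generating series of the
   sum over [t] between [-s] and [s] is a geometric sum, i.e. the difference of
   the tails starting at [t = -s] and at [t = s]: these are [cminus] and
   [cplus].  The sign of [j] merges the contributions of [e] and [-e]. *)
Definition cminus m (v : Z * Z * Z * Z) := let: (s, e, x, j) := v in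
  [&& 0 <? s, 0 <? e, 0 <? x, oddZ s, oddZ e, oddZ x &
      2 * m =? (s - e) * (s - e) + 2 * s * x + 4 * e * Z.abs j].

Definition cplus m (v : Z * Z * Z * Z) := let: (s, e, x, j) := v in
  [&& 0 <? s, 0 <? e, 0 <? x, oddZ s, oddZ e, oddZ x &
      2 * m =? (s + e) * (s + e) + 2 * s * x + 4 * e * Z.abs j].

(* For fixed [k], where [2 k = |s - e|] in [cminus] and [2 k = s + e] in
   [cplus], [aset] collects the terms of the telescoping sum. *)
Definition aset m (v : Z * Z * Z * Z) := let: (k, a, x, i) := v in
  [&& 0 <? k, 0 <? a, 0 <? x, oddZ a, oddZ x &
      m =? 2 * k * k + a * x + 2 * k * Z.abs i].

Definition near_s (v : Z * Z * Z * Z) := let: (s, e, x, j) := v in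
  (- s <? j) && (j <=? s).
Definition near_x (v : Z * Z * Z * Z) := let: (k, a, x, i) := v in
  (- x <? i) && (i <=? x).
Definition diag (v : Z * Z * Z * Z) := let: (s, e, x, j) := v in s =? e.
Definition small_a (v : Z * Z * Z * Z) := let: (k, a, x, i) := v in a <? 2 * k.

Definition inbox L (v : Z * Z * Z * Z) := let: (x, y, z, f) := v in
  - L <= x <= L /\ - L <= y <= L /\ - L <= z <= L /\ - L <= f <= L.

Lemma inboxE L v : inbox L v -> v \in box4 L.
Proof. by move: v => [[[x y] z] f] /=; rewrite !mem_boxes; lia. Qed.

Lemma cone_inbox L m v : 4 * m <= L -> cone m v -> inbox L v.
Proof. 
move: v => [[[x y] z] f] /= mL h.
have {h}[? [? [? ?]]] : 0 < x /\ 0 < y /\ 0 <= z /\ m = x * (y + z) + 2 * y * z + 2 * f * f by lia.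
have : 0 <= y * z by nia.
have : 0 <= (x-1) * (y+z-1) by nia.
have := @abs_le_sqr f.
lia.
Qed.

Lemma cminus_inbox L m v : 4 * m <= L -> cminus m v -> inbox L v.
Proof.
move: v => [[[s e] x] j] /= mL h.
have {h}[? [? [? h]]] : 0 < s /\ 0 < e /\ 0 < x /\ 2 * m = (s - e) * (s - e) + 2 * s * x + 4 * e * Z.abs j by lia.
have := @abs_le_sqr (s - e).
have : 0 <= (s-1) * (x-1) by nia.
have : 0 <= (e-1) * Z.abs j by nia.
lia.
Qed.

Lemma cplus_inbox L m v : 4 * m <= L -> cplus m v -> inbox L v.
Proof.
move: v => [[[s e] x] j] /= mL h.
have {h}[? [? [? h]]] : 0 < s /\ 0 < e /\ 0 < x /\ 2 * m = (s + e) * (s + e) + 2 * s * x + 4 * e * Z.abs j by lia.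
have := @abs_le_sqr (s + e).
have : 0 <= (s-1) * (x-1) by nia.
have : 0 <= (e-1) * Z.abs j by nia.
lia.
Qed.

Lemma aset_inbox L m v : 4 * m <= L -> aset m v -> inbox L v.
Proof.
move: v => [[[s e] x] j] /= mL h.
have {h}[? [? [? h]]] : 0 < s /\ 0 < e /\ 0 < x /\ m = 2 * s * s + e * x + 2 * s * Z.abs j by lia.
have : 0 <= s * (s-1) by nia.
have : 0 <= (e-1) * (x-1) by nia.
have : 0 <= (s-1) * Z.abs j by nia.
lia.
Qed.

Lemma Zcard_box4 L (P Q : pred (Z * Z * Z * Z)) f g :
  (forall v, P v -> inbox L v) -> (forall v, Q v -> inbox L v) ->
  (forall v, P v -> Q (f v) /\ g (f v) = v) ->
  (forall v, Q v -> P (g v) /\ f (g v) = v) ->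
  Zcard (box4 L) P = Zcard (box4 L) Q.
Proof.
move=> PL QL fP gP; apply/esym/(Zcard_bij (f := f) (g := g)); try exact: box4_uniq.
  by move=> v _ /fP[Qf]; split=> //; apply/inboxE/QL.
by move=> v _ /gP[Pg]; split=> //; apply/inboxE/PL.
Qed.

Lemma coneP m x y z f :
  reflect [/\ 0 < x, 0 < y, 0 <= z & m = x * (y + z) + 2 * y * z + 2 * f * f]
    (cone m (x, y, z, f)).
Proof. by apply: (iffP and4P) => -[? ? ? ?]; split; lia. Qed.

Lemma cminusP m s e x j :
  reflect (exists s' e' x', [/\ s = 2 * s' + 1, e = 2 * e' + 1, x = 2 * x' + 1,
     0 <= s' /\ 0 <= e' /\ 0 <= x' &
     2 * m = (s - e) * (s - e) + 2 * s * x + 4 * e * Z.abs j])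
    (cminus m (s, e, x, j)).
Proof.
apply: (iffP idP) => [/and5P[? ? ? /oddZE[s' Es] /and3P[/oddZE[e' Ee] /oddZE[x' Ex]]]|].
  by move=> h; exists s', e', x'; split; lia.
move=> [s' [e' [x' [-> -> -> [? [? ?]] h]]]].
by apply/and5P; split; rewrite /oddZ; try lia; apply/and3P; split; lia.
Qed.

Lemma cplusP m s e x j :
  reflect (exists s' e' x', [/\ s = 2 * s' + 1, e = 2 * e' + 1, x = 2 * x' + 1,
     0 <= s' /\ 0 <= e' /\ 0 <= x' &
     2 * m = (s + e) * (s + e) + 2 * s * x + 4 * e * Z.abs j])
    (cplus m (s, e, x, j)).
Proof.
apply: (iffP idP) => [/and5P[? ? ? /oddZE[s' Es] /and3P[/oddZE[e' Ee] /oddZE[x' Ex]]]|].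
  by move=> h; exists s', e', x'; split; lia.
move=> [s' [e' [x' [-> -> -> [? [? ?]] h]]]].
by apply/and5P; split; rewrite /oddZ; try lia; apply/and3P; split; lia.
Qed.

Lemma asetP m k a x i :
  reflect (exists a' x', [/\ a = 2 * a' + 1, x = 2 * x' + 1,
     0 < k /\ 0 <= a' /\ 0 <= x' &
     m = 2 * k * k + a * x + 2 * k * Z.abs i])
    (aset m (k, a, x, i)).
Proof.
apply: (iffP idP) => [/and5P[? ? ? /oddZE[s' Es] /andP[/oddZE[e' Ee] ?]]|].
  by exists s', e'; split; lia.
move=> [s' [e' [-> -> [? [? ?]] h]]].
by apply/and5P; split; rewrite /oddZ; try lia; apply/andP; split; lia.
Qed.

Lemma oddZ_mul x y : oddZ (x * y) -> oddZ x && oddZ y.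
Proof.
rewrite /oddZ => /Z.eqb_spec h.
have hx := Z.mod_pos_bound x 2; have hy := Z.mod_pos_bound y 2.
rewrite Z.mul_mod // in h.
have [hx0|hx1] : x mod 2 = 0 \/ x mod 2 = 1 by lia.
  by rewrite hx0 in h.
have [hy0|->] : y mod 2 = 0 \/ y mod 2 = 1 by lia.
  by rewrite hx1 hy0 in h.
by rewrite hx1.
Qed.

(** Oddness of [m] makes [s] odd, hence [e] odd and nonzero. Writing [t = 2 y - s] if [e > 0] and
    [t = s - 2 z] if [e < 0] turns [2 t e] into [4 |e| |j| - 2 s |e|], with [j = y] in [[1, s]] or
    [j = - z] in [[1 - s, 0]]; together these fill the window [near_s]. *)
Lemma cone_cminus L m : 4 * m <= L -> oddZ m ->
  Zcard (box4 L) (cone m) =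
  Zcard (box4 L) (predI (cminus m) near_s).
Proof.
move=> mL om.
pose f (v : Z * Z * Z * Z) := let: (x, y, z, f) := v in
  let e := 2 * f - y + z in
  if 0 <? e then (y + z, e, x, y) else (y + z, - e, x, - z).
pose g (v : Z * Z * Z * Z) := let: (s, e, x, j) := v in
  if 0 <? j then (x, j, s - j, (e - s) / 2 + j)
  else (x, s + j, - j, (s - e) / 2 + j).
apply: (Zcard_box4 (f := f) (g := g)).
- by move=> v; apply: cone_inbox.
- by move=> v /andP[/(cminus_inbox mL)].
- move=> [[[x y] z] i] /coneP[hx hy hz h].
  have /andP[/oddZE[x' Ex] /oddZE[s' Es]] : oddZ x && oddZ (y + z).
    by apply: oddZ_mul; move: om; rewrite /oddZ; lia.
  have Ey : y = 2 * s' + 1 - z by lia.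
  rewrite /f; case: ifP => he; split.
  + apply/andP; split; last by rewrite /near_s; lia.
    by apply/cminusP; exists s', (i - s' - 1 + z), x'; split; rewrite ?(Z.abs_eq y); lia.
  + rewrite /g (_ : 0 <? y); last by lia.
    rewrite (_ : _ / 2 = i - y); last by lia.
    by congr (_, _, _, _); lia.
  + apply/andP; split; last by rewrite /near_s; lia.
    by apply/cminusP; exists s', (s' - i - z), x'; split; rewrite ?Z.abs_neq; lia.
  + rewrite /g (_ : (0 <? - z) = false); last by lia.
    rewrite (_ : _ / 2 = i + z); last by lia.
    by congr (_, _, _, _); lia.
- move=> [[[s e] x] j] /andP[/cminusP[s' [e' [x' [-> -> -> [? [? ?]] h]]]]].
  rewrite /near_s /= => hj; rewrite /g; case: ifP => j0.
    rewrite (_ : _ / 2 = e' - s'); last by lia.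
    rewrite Z.abs_eq in h; last by lia.
    split; first by apply/coneP; split; lia.
    by rewrite /f ifT; [congr (_, _, _, _); lia | lia].
  rewrite (_ : _ / 2 = s' - e'); last by lia.
  rewrite Z.abs_neq in h; last by lia.
  split; first by apply/coneP; split; lia.
  by rewrite /f ifF; [congr (_, _, _, _); lia | lia].
Qed.

(** Since [(s - e)^2 + 4 e s = (s + e)^2], moving [j] by [s] towards 0 trades one equation for the
    other. The value [j = - s], which lies outside the half-open window, provides [j = 0]. *)
Lemma cminus_cplus L m : 4 * m <= L ->
  Zcard (box4 L) (predI (cminus m) (predC near_s)) =
  Zcard (box4 L) (cplus m).
Proof.
move=> mL.
pose f (v : Z * Z * Z * Z) := let: (s, e, x, j) := v in
  (s, e, x, if 0 <? j then j - s else j + s).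
pose g (v : Z * Z * Z * Z) := let: (s, e, x, j) := v in
  (s, e, x, if 0 <? j then j + s else j - s).
apply: (Zcard_box4 (f := f) (g := g)).
- by move=> v /andP[/(cminus_inbox mL)].
- by move=> v /(cplus_inbox mL).
- move=> [[[s e] x] j] /andP[/cminusP[s' [e' [x' [Es Ee Ex [? [? ?]] h]]]]].
  rewrite /= /near_s => far; rewrite /f /g; case: ifP => j0; split.
  + apply/cplusP; exists s', e', x'; split=> //.
    by (rewrite (Z.abs_eq j) in h; [|lia]); rewrite Z.abs_eq; lia.
  + by congr (_, _, _, _); case: ifP; lia.
  + apply/cplusP; exists s', e', x'; split=> //.
    by (rewrite (Z.abs_neq j) in h; [|lia]); rewrite Z.abs_neq; lia.
  + by congr (_, _, _, _); case: ifP; lia.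
- move=> [[[s e] x] j] /cplusP[s' [e' [x' [Es Ee Ex [? [? ?]] h]]]].
  rewrite /f /g; case: ifP => j0; split.
  + apply/andP; split; last by rewrite /= /near_s; lia.
    apply/cminusP; exists s', e', x'; split=> //.
    by (rewrite (Z.abs_eq j) in h; [|lia]); rewrite Z.abs_eq; lia.
  + by congr (_, _, _, _); case: ifP; lia.
  + apply/andP; split; last by rewrite /= /near_s; lia.
    apply/cminusP; exists s', e', x'; split=> //.
    by (rewrite (Z.abs_neq j) in h; [|lia]); rewrite Z.abs_neq; lia.
  + by congr (_, _, _, _); case: ifP; lia.
Qed.

(** Moving [i] by [x] towards 0 is paid for by [a + 2 k] in place of [a]. Conversely [a >= 2 k]
    leaves [a - 2 k > 0] because [a] is odd. *)
Lemma aset_far L m : 4 * m <= L ->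
  Zcard (box4 L) (predI (aset m) (predC near_x)) =
  Zcard (box4 L) (predI (aset m) (predC small_a)).
Proof.
move=> mL.
pose f (v : Z * Z * Z * Z) := let: (k, a, x, i) := v in
  (k, a + 2 * k, x, if 0 <? i then i - x else i + x).
pose g (v : Z * Z * Z * Z) := let: (k, a, x, i) := v in
  (k, a - 2 * k, x, if 0 <? i then i + x else i - x).
apply: (Zcard_box4 (f := f) (g := g)).
- by move=> v /andP[/(aset_inbox mL)].
- by move=> v /andP[/(aset_inbox mL)].
- move=> [[[k a] x] i] /andP[/asetP[a' [x' [Ea Ex [? [? ?]] h]]]].
  rewrite /= /near_x => far; rewrite /f /g; split.
    apply/andP; split; last by rewrite /= /small_a; lia.
    apply/asetP; exists (a' + k), x'; split; try lia.
    by case: ifP => i0; [(rewrite (Z.abs_eq i) in h; [|lia]); rewrite Z.abs_eq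
      |(rewrite (Z.abs_neq i) in h; [|lia]); rewrite Z.abs_neq]; lia.
  by case: (Z.ltb_spec 0 i) => i0; congr (_, _, _, _); try case: ifP; lia.
- move=> [[[k a] x] i] /andP[/asetP[a' [x' [Ea Ex [? [? ?]] h]]]].
  rewrite /= /small_a => far; rewrite /f /g; split.
    apply/andP; split; last by rewrite /= /near_x; case: ifP; lia.
    apply/asetP; exists (a' - k), x'; split; try lia.
    by case: ifP => i0; [(rewrite (Z.abs_eq i) in h; [|lia]); rewrite Z.abs_eq
      |(rewrite (Z.abs_neq i) in h; [|lia]); rewrite Z.abs_neq]; lia.
  by case: (Z.ltb_spec 0 i) => i0; congr (_, _, _, _); try case: ifP; lia.
Qed.

(** Here [2 k = |s - e|] and [a] is the smaller of [s] and [e]. Eliminating the larger one gives an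
    even [i = 2 j] if [s < e] and an odd [i] with [|i| = x] if [s > e], so the parity of [i] tells
    the cases apart. *)
Lemma aset_near L m : 4 * m <= L ->
  Zcard (box4 L) (predI (cminus m) (predC diag)) =
  Zcard (box4 L) (predI (aset m) near_x).
Proof.
move=> mL.
pose f (v : Z * Z * Z * Z) := let: (s, e, x, j) := v in
  if s <? e then ((e - s) / 2, s, x + 2 * Z.abs j, 2 * j)
  else ((s - e) / 2, e, x + 2 * Z.abs j, if 0 <=? j then x else - x).
pose g (v : Z * Z * Z * Z) := let: (k, a, x, i) := v in
  if i mod 2 =? 0 then (a, a + 2 * k, x - Z.abs i, i / 2)
  else (a + 2 * k, a, Z.abs i,
        if 0 <=? i then (x - Z.abs i) / 2 else - ((x - Z.abs i) / 2)).
apply: (Zcard_box4 (f := f) (g := g)).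
- by move=> v /andP[/(cminus_inbox mL)].
- by move=> v /andP[/(aset_inbox mL)].
- move=> [[[s e] x] j] /andP[/cminusP[s' [e' [x' [-> -> -> [? [? ?]] h]]]]].
  rewrite /= /diag => nd; rewrite /f; case: ifP => lt.
    rewrite (_ : _ / 2 = e' - s'); last by lia.
    split.
      apply/andP; split; last by rewrite /near_x; lia.
      by apply/asetP; exists s', (x' + Z.abs j); split; lia.
    rewrite /g (_ : (_ mod 2 =? 0) = true); last by lia.
    by congr (_, _, _, _); lia.
  rewrite (_ : _ / 2 = s' - e'); last by lia.
  have ax : Z.abs (if 0 <=? j then 2 * x' + 1 else - (2 * x' + 1)) = 2 * x' + 1.
    by case: ifP; lia.
  split.
    apply/andP; split; last by rewrite /near_x; case: ifP; lia.
    by apply/asetP; exists e', (x' + Z.abs j); split; rewrite ?ax; lia.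
  rewrite /g ax (_ : (_ mod 2 =? 0) = false); last by case: ifP; lia.
  by case: (Z.leb_spec 0 j) => ?; congr (_, _, _, _); try case: ifP; lia.
- move=> [[[k a] x] i] /andP[/asetP[a' [x' [-> -> [? [? ?]] h]]]].
  rewrite /near_x => nr; rewrite /g; case: ifP => par.
    have {par}[j Ei] : exists j, i = 2 * j by exists (i / 2); lia.
    have aj : Z.abs i = 2 * Z.abs j by lia.
    rewrite aj in h *; rewrite Ei (_ : _ / 2 = j); last by lia.
    split.
      apply/andP; split; last by rewrite /= /diag; lia.
      by apply/cminusP; exists a', (a' + k), (x' - Z.abs j); split; lia.
    by rewrite /f ifT; [congr (_, _, _, _); lia | lia].
  have {par}[j Ei] : exists j, Z.abs i = 2 * j + 1 by exists (Z.abs i / 2); lia.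
  rewrite Ei in h *.
  rewrite (_ : (_ - _) / 2 = x' - j); last by lia.
  have aj : Z.abs (if 0 <=? i then x' - j else - (x' - j)) = x' - j.
    by case: ifP; lia.
  split.
    apply/andP; split; last by rewrite /= /diag; lia.
    by apply/cminusP; exists (a' + k), a', j; split; lia.
  rewrite /f ifF; last by lia.
  by rewrite aj; case: (Z.leb_spec 0 i) => ?; congr (_, _, _, _); try case: ifP; lia.
Qed.

(** Now [2 k = s + e], and either [e] or [s] is eliminated according to the sign of [x - 2 |j|],
    which is nonzero because [x] is odd. Again the parity of [i] records the case, and [a < 2 k]
    keeps the eliminated variable positive. *)
Lemma aset_cplus L m : 4 * m <= L ->
  Zcard (box4 L) (cplus m) =
  Zcard (box4 L) (predI (aset m) small_a).
Proof.
move=> mL.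
pose f (v : Z * Z * Z * Z) := let: (s, e, x, j) := v in
  if 0 <? x - 2 * Z.abs j then ((s + e) / 2, s, x - 2 * Z.abs j, 2 * j)
  else ((s + e) / 2, e, 2 * Z.abs j - x, if 0 <? j then x else - x).
pose g (v : Z * Z * Z * Z) := let: (k, a, x, i) := v in
  if i mod 2 =? 0 then (a, 2 * k - a, x + Z.abs i, i / 2)
  else (2 * k - a, a, Z.abs i,
        if 0 <? i then (x + Z.abs i) / 2 else - ((x + Z.abs i) / 2)).
apply: (Zcard_box4 (f := f) (g := g)).
- by move=> v /(cplus_inbox mL).
- by move=> v /andP[/(aset_inbox mL)].
- move=> [[[s e] x] j] /cplusP[s' [e' [x' [-> -> -> [? [? ?]] h]]]].
  rewrite /f; case: ifP => lt.
    rewrite (_ : _ / 2 = e' + s' + 1); last by lia.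
    split.
      apply/andP; split; last by rewrite /small_a; lia.
      by apply/asetP; exists s', (x' - Z.abs j); split; lia.
    rewrite /g (_ : (_ mod 2 =? 0) = true); last by lia.
    by congr (_, _, _, _); lia.
  rewrite (_ : _ / 2 = s' + e' + 1); last by lia.
  have ax : Z.abs (if 0 <? j then 2 * x' + 1 else - (2 * x' + 1)) = 2 * x' + 1.
    by case: ifP; lia.
  split.
    apply/andP; split; last by rewrite /small_a; lia.
    by apply/asetP; exists e', (Z.abs j - x' - 1); split; rewrite ?ax; lia.
  rewrite /g ax (_ : (_ mod 2 =? 0) = false); last by case: ifP; lia.
  by case: (Z.ltb_spec 0 j) => ?; congr (_, _, _, _); try case: ifP; lia.
- move=> [[[k a] x] i] /andP[/asetP[a' [x' [-> -> [? [? ?]] h]]]].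
  rewrite /small_a => nr; rewrite /g; case: ifP => par.
    have {par}[j Ei] : exists j, i = 2 * j by exists (i / 2); lia.
    have aj : Z.abs i = 2 * Z.abs j by lia.
    rewrite aj in h *; rewrite Ei (_ : _ / 2 = j); last by lia.
    split.
      by apply/cplusP; exists a', (k - a' - 1), (x' + Z.abs j); split; lia.
    by rewrite /f ifT; [congr (_, _, _, _); lia | lia].
  have {par}[j Ei] : exists j, Z.abs i = 2 * j + 1 by exists (Z.abs i / 2); lia.
  rewrite Ei in h *.
  rewrite (_ : (_ + _) / 2 = x' + j + 1); last by lia.
  have aj : Z.abs (if 0 <? i then x' + j + 1 else - (x' + j + 1)) = x' + j + 1.
    by case: ifP; lia.
  split.
    by apply/cplusP; exists (k - a' - 1), a', j; split; rewrite ?aj; lia.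
  rewrite /f aj ifF; last by lia.
  by case: (Z.ltb_spec 0 i) => ?; congr (_, _, _, _); try case: ifP; lia.
Qed.

Lemma cone_diag L m : 4 * m <= L -> oddZ m ->
  Zcard (box4 L) (cone m) = Zcard (box4 L) (predI (cminus m) diag).
Proof.
move=> mL om; pose N (P : pred (Z * Z * Z * Z)) := Zcard (box4 L) P.
have split_by (Q P : pred (Z * Z * Z * Z)) :
  N P = N (predI P Q) + N (predI P (predC Q)) by exact: Zcard_split.
have N1 : N (cone m) = N (predI (cminus m) near_s) := cone_cminus mL om.
have N2 : N (predI (cminus m) (predC near_s)) = N (cplus m) := cminus_cplus mL.
have N3 : N (predI (cminus m) (predC diag)) = N (predI (aset m) near_x) :=
  aset_near mL.
have N4 : N (cplus m) = N (predI (aset m) small_a) := aset_cplus mL.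
have N5 : N (predI (aset m) (predC near_x)) = N (predI (aset m) (predC small_a)) :=
  aset_far mL.
(* The two splittings of [aset] give [near_x] and [small_a] equally many points, so [cplus] matches
   [cminus] off the diagonal; subtracting from the two splittings of [cminus] leaves [cone] against
   [diag]. *)
have := split_by near_s (cminus m); have := split_by diag (cminus m).
have := split_by near_x (aset m); have := split_by small_a (aset m).
rewrite -!/(N _); lia.
Qed.

(** * Divisor sums *)

Lemma Zcard_centered L d : oddZ d -> 0 < d <= L ->
  Zcard (box L) (fun j => 2 * Z.abs j <? d) = d.
Proof.
move=> /oddZE[c Ed] dL.
pose f (i : nat) := Z.of_nat i - c.
pose g (j : Z) := Z.to_nat (j + c).
rewrite (@Zcard_bij _ _ (iota 0 (Z.to_nat d)) _ predT _ f g).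
- by rewrite /Zcard big_const_seq count_predT size_iota iter_addr_0; lia.
- exact: iota_uniq.
- exact: box_uniq.
- by move=> i; rewrite mem_iota mem_box /f /g /= => ? ?; split; lia.
- by move=> i; rewrite mem_iota mem_box /f /g /= => ? ?; split; lia.
Qed.

Definition factors m (v : Z * Z) := let: (d, e) := v in
  [&& 0 <? d, 0 <? e & m =? d * e].

(** The divisor sum of [m] when [m <= L]; it vanishes for [m <= 0], as the recurrences require. *)
Definition sigmaZ L m : Z := (\sum_(v <- box2 L | factors m v) v.1)%R.

(** For [s = e] the equation is [m = s (x + 2 |j|)]: a divisor [d = x + 2 |j|] arises once for each
    [j] with [2 |j| < d], that is [d] times, [d] being odd. *)
Lemma sigmaZ_diag L m : 4 * m <= L -> oddZ m ->
  sigmaZ L m = Zcard (box4 L) (predI (cminus m) diag).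
Proof.
move=> mL om.
pose P (v : Z * Z * Z) := let: (d, s, j) := v in
   factors m (d, s) && (2 * Z.abs j <? d).
have -> : sigmaZ L m = Zcard (box3 L) P.
  rewrite /sigmaZ /Zcard /box3 big_mkcond [RHS]big_mkcond.
  rewrite [RHS]big_allpairs_dep; apply: eq_big_seq => -[d s]; rewrite !mem_boxes => ds.
  rewrite /P; case: ifP => [F|_]; last by rewrite big1.
  have od : oddZ d.
    move: F => /and3P[_ _ /Z.eqb_spec Em].
    by move: om; rewrite Em => /oddZ_mul/andP[].
  rewrite -big_mkcond /=; apply/esym/Zcard_centered => //.
  by move: F => /and3P[? _ _]; lia.
pose f (v : Z * Z * Z) := let: (d, s, j) := v in (s, s, d - 2 * Z.abs j, j).
pose g (v : Z * Z * Z * Z) := let: (s, e, x, j) := v in (x + 2 * Z.abs j, s, j).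
apply/esym/(Zcard_bij (f := f) (g := g)); [exact: box3_uniq|exact: box4_uniq| |].
  move=> [[d s] j] _ /andP[/and3P[d0 s0 /Z.eqb_spec Em] h].
  have /andP[/oddZE[d' Ed] /oddZE[s' Es]] : oddZ d && oddZ s.
    by apply: oddZ_mul; rewrite -Em.
  have : predI (cminus m) diag (f (d, s, j)).
    apply/andP; split; last by rewrite /diag /=; lia.
    by apply/cminusP; exists s', s', (d' - Z.abs j); split; lia.
  move=> /[dup] /andP[/(cminus_inbox mL)/inboxE fb _] ->; split=> //.
  by rewrite /g /f; congr (_, _, _); lia.
move=> [[[s e] x] j] _ /andP[C]; rewrite /diag => /Z.eqb_spec Ee.
have := cminus_inbox mL C; move: C; rewrite -Ee.
move=> /cminusP[s' [e' [x' [-> _ -> [? [? ?]] h]]]] [? [? ?]].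
have Em : m = (2 * x' + 1 + 2 * Z.abs j) * (2 * s' + 1) by lia.
have xm : 2 * x' + 1 + 2 * Z.abs j <= m by nia.
split; last by rewrite /f /g; congr (_, _, _, _); lia.
  by rewrite !mem_boxes; lia.
by apply/andP; split; [apply/and3P; split; lia|lia].
Qed.

(** * Four triangular numbers *)

Definition uset M (v : Z * Z * Z) := let: (d, e, x) := v in
  [&& 0 <? d, 0 <? e & M =? x * x + 4 * d * e].

Lemma usetP M d e x :
  reflect [/\ 0 < d, 0 < e & M = x * x + 4 * d * e] (uset M (d, e, x)).
Proof. by apply: (iffP and3P) => -[? ? ?]; split; lia. Qed.

Lemma uset_box L M v : M <= L -> uset M v -> v \in box3 L.
Proof.
move: v => [[d e] x] ML /usetP[d0 e0 h]; have := @abs_le_sqr x.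
have : 0 <= (d - 1) * (e - 1) by nia.
by rewrite !mem_boxes; lia.
Qed.

(** For the form [d X^2 + x X Y - e Y^2] of discriminant [M], this says that its value at [(1, -1)]
    is negative. *)
Definition zagier (v : Z * Z * Z) := let: (d, e, x) := v in 0 <? e + x - d.

Section ZagierSum.

Variables (L M : Z).
Hypothesis ML : M <= L.
Hypothesis M_mod8 : M mod 8 = 5.

(** The involution fixes [d] and exchanges the positive numbers [e] and [e + x - d]. *)
Lemma zagier_reflect (F : Z * Z * Z -> Z) :
  (\sum_(v <- box3 L | predI (uset M) zagier v) F v =
   \sum_(v <- box3 L | predI (uset M) zagier v)
      (let: (d, e, x) := v in F (d, e + x - d, (2 * d - x))))%R.
Proof.
pose f (v : Z * Z * Z) := let: (d, e, x) := v in (d, e + x - d, 2 * d - x).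
have fP v : predI (uset M) zagier v ->
    [/\ f v \in box3 L, predI (uset M) zagier (f v) & f (f v) = v].
  move: v => [[d e] x] /andP[/usetP[d0 e0 h] h0].
  have Uf : uset M (f (d, e, x)) by move: h0; rewrite /zagier => h0; apply/usetP; split; lia.
  split; [exact: uset_box Uf| |by congr (_, _, _); lia].
  by apply/andP; split=> //; rewrite /zagier /f; lia.
rewrite (reindex_seq (P := predI (uset M) zagier) (f := f) (g := f) _ (box3_uniq L) (box3_uniq L)).
- by apply: eq_bigr => -[[d e] x].
- by move=> v _; apply: fP.
- by move=> v _; apply: fP.
Qed.

(* On the complement of [zagier], [(d, e, x)] is the image of a point of
   [zagier] under [(d, e, x) |-> (e + x - d, d, x - 2 d)], because [M] is not a
   square. *)
Lemma sum_zagier (F : Z * Z * Z -> Z) :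
  (\sum_(v <- box3 L | uset M v) F v =
   \sum_(v <- box3 L | predI (uset M) zagier v)
      (let: (d, e, x) := v in F (d, e, x) + F (e + x - d, d, x - 2 * d)))%R.
Proof.
rewrite (bigID zagier) /=.
pose f (v : Z * Z * Z) := let: (d, e, x) := v in (e + x - d, d, x - 2 * d).
pose g (v : Z * Z * Z) := let: (d, e, x) := v in (e, d - x - e, x + 2 * e).
rewrite [X in (_ + X)%R](reindex_seq (P := predI (uset M) zagier)
  (f := f) (g := g) _ (box3_uniq L) (box3_uniq L)).
- by rewrite -big_split; apply: eq_bigr => -[[d e] x].
- move=> [[d e] x] _ /andP[/usetP[d0 e0 h] h0].
  have {h0}h1 : 0 <? e + x - d by exact: h0.
  have Uf : uset M (f (d, e, x)) by apply/usetP; split; lia.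
  split; [exact: uset_box Uf| |by congr (_, _, _); lia].
  by apply/andP; split; [exact: Uf|rewrite /zagier /f; lia].
- move=> [[d e] x] _ /andP[/usetP[d0 e0 h] h0].
  have {h0}h1 : ~~ (0 <? e + x - d) by exact: h0.
  have h2 : e + x - d <> 0.
    move=> h2; have Em : M = (x - 2 * d) * (x - 2 * d).
      by rewrite h (_ : e = d - x); lia.
    move: M_mod8; rewrite Em Z.mul_mod //.
    have := Z.mod_pos_bound (x - 2 * d) 8 erefl.
    move: (_ mod 8) => r rb.
    have : r = 0 \/ r = 1 \/ r = 2 \/ r = 3 \/ r = 4 \/ r = 5 \/ r = 6 \/ r = 7.
      by lia.
    by do ![case=> [->//|]] => ->.
  have Ug : uset M (g (d, e, x)) by apply/usetP; split; lia.
  split; [exact: uset_box Ug| |by congr (_, _, _); lia].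
  by apply/andP; split=> //; rewrite /= /zagier /g; lia.
Qed.

Lemma sum_odd_x (G : Z * Z * Z -> Z) :
  (forall d e x, G (d, e, - x) = - G (d, e, x)) ->
  (\sum_(v <- box3 L | uset M v) G v = 0)%R.
Proof.
move=> oddG; set S := (\sum_(_ <- _ | _) _)%R.
suff : S = - S by lia.
pose f (v : Z * Z * Z) := let: (d, e, x) := v in (d, e, - x).
have fP v : uset M v -> [/\ f v \in box3 L, uset M (f v) & f (f v) = v].
  move: v => [[d e] x] /usetP[d0 e0 h].
  have Uf : uset M (f (d, e, x)) by apply/usetP; split; lia.
  by split; [exact: uset_box Uf| |congr (_, _, _); lia].
rewrite {1}/S (reindex_seq (P := uset M) (f := f) (g := f) _ (box3_uniq L) (box3_uniq L)).
- rewrite /S (big_morph Z.opp (id1 := 0) (op1 := Z.add)) //; last by move=> ? ?; lia.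
  by apply: eq_bigr => -[[d e] x] _; apply: oddG.
- by move=> v _; apply: fP.
- by move=> v _; apply: fP.
Qed.

Lemma zagier_sum0 :
  (\sum_(v <- box3 L | uset M v)
     (let: (d, e, x) := v in (d * e - x * x) * d : Z) = 0)%R.
Proof.
(* The odd function [G] is chosen so that the summand on [zagier] becomes
   antisymmetric under the involution of [zagier_reflect]. *)
pose F (v : Z * Z * Z) := let: (d, e, x) := v in (d * e - x * x) * d.
pose G (v : Z * Z * Z) := let: (d, e, x) := v in x * d * d.
rewrite -[LHS]/(\sum_(v <- box3 L | uset M v) F v)%R.
have G0 : (\sum_(v <- box3 L | uset M v) G v = 0)%R.
  by apply: sum_odd_x => d e x; rewrite /G; lia.
have -> : (\sum_(v <- box3 L | uset M v) F v =
           \sum_(v <- box3 L | uset M v) (F v + G v))%R.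
  by rewrite big_split /= G0 addr0.
rewrite (sum_zagier (fun v => F v + G v)%R); set S := LHS.
suff : (S + S = 0)%R by lia.
rewrite {1}/S zagier_reflect /S -big_split big1 //= => -[[d e] x] _.
by rewrite /F /G; lia.
Qed.

End ZagierSum.

(** Over all integers [i], this takes each triangular number exactly once. *)
Definition tri i := 2 * i * i + i.

Lemma tri_ge i : Z.abs i <= tri i.
Proof. by have := @abs_le_sqr i; rewrite /tri; lia. Qed.

Lemma tri_gt0 i : i <> 0 -> 0 < tri i.
Proof. by have := @tri_ge i; lia. Qed.

Definition quad k (v : Z * Z * Z * Z) := let: (i, j, p, q) := v in
  tri i + tri j + tri p + tri q =? k.

Lemma quad_inbox L k v : k <= L -> quad k v -> inbox L v.
Proof.
move: v => [[[i j] p] q] kL; rewrite /quad /inbox.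
by have := @tri_ge i; have := @tri_ge j; have := @tri_ge p; have := @tri_ge q; lia.
Qed.

(** * Recurrences and their uniqueness *)

Lemma Zcard_pairs (T U : eqType) (s : seq T) (t : seq U) (P : pred (T * U)) :
  Zcard [seq (x, y) | x <- s, y <- t] P =
  (\sum_(y <- t) Zcard s (fun x => P (x, y)))%R.
Proof.
rewrite /Zcard big_mkcond big_allpairs_dep exchange_big /=.
by apply: eq_bigr => y _; rewrite -big_mkcond.
Qed.

(** By strong induction only the term [i = 0] of the recurrence survives, which gives
    [c k 0 * D k = 0]. Where [c k 0] vanishes the recurrence says nothing, so [D k = 0] is assumed
    there. *)
Lemma shift_rec_eq0 L K (t : Z -> Z) (c : Z -> Z -> Z) (D : Z -> Z) :
  0 <= L -> t 0 = 0 -> (forall i, i <> 0 -> 0 < t i) ->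
  (forall k, k < 0 -> D k = 0) ->
  (forall k, 0 <= k <= K -> c k 0 = 0 -> D k = 0) ->
  (forall k, 0 <= k <= K -> (\sum_(i <- box L) c k i * D (k - t i)%Z = 0)%R) ->
  forall k, k <= K -> D k = 0.
Proof.
move=> L0 t0 tpos Dneg D0 rec k.
have [/Dneg->//|k0] := Z.lt_ge_cases k 0.
move: k k0; apply: (Z_lt_induction (fun k => k <= K -> D k = 0)) => k IH kK.
have [/Dneg->//|k0] := Z.lt_ge_cases k 0.
have := rec k ltac:(lia); rewrite (bigD1_seq 0) ?box_uniq ?mem_box //=; last by lia.
rewrite big1_seq ?addr0 => [|i /andP[/eqP/tpos ti _]]; last first.
  have [/Dneg->|k1] := Z.lt_ge_cases (k - t i) 0; first by rewrite mulr0.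
  by rewrite IH ?mulr0; lia.
rewrite t0 Z.sub_0_r.
by move=> /Z.mul_eq_0[|//]; apply: D0; lia.
Qed.

(** The sum runs over five triangular numbers of total [k], weighted by [k - 5 tri r] for the last
    one. By symmetry [tri r] may be replaced by the average of all five, which is [k / 5]. *)
Lemma quad_rec L k :
  (\sum_(i <- box L)
     (k - 5 * tri i)%Z * Zcard (box4 L) (quad (k - tri i)) = 0)%R.
Proof.
pose box5 := [seq (v, r) | v <- box4 L, r <- box L].
have box5u : uniq box5 by rewrite pairs_uniq ?box4_uniq ?box_uniq.
pose P (w : Z * Z * Z * Z * Z) := quad (k - tri w.2) w.1.
have sym (f : Z * Z * Z * Z * Z -> Z * Z * Z * Z * Z) (F : Z * Z * Z * Z * Z -> Z):
    (forall w, w \in box5 -> P w -> [/\ f w \in box5, P (f w) & f (f w) = w]) ->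
    (\sum_(w <- box5 | P w) F w = \sum_(w <- box5 | P w) F (f w))%R.
  by move=> fP; apply: (reindex_seq _ box5u box5u fP fP).
pose S (F : Z * Z * Z * Z * Z -> Z) := (\sum_(w <- box5 | P w) F w)%R.
have E : (\sum_(i <- box L)
     (k - 5 * tri i)%Z * Zcard (box4 L) (quad (k - tri i)))%R =
     S (fun w => k - 5 * tri w.2).
  rewrite /S /box5 [RHS]big_mkcond [RHS]big_allpairs_dep exchange_big /=.
  apply: eq_bigr => i _; rewrite -big_mkcond /= /Zcard big_distrr /=.
  by apply: eq_bigr => v _; rewrite mulr1.
have SD F G : S F + S G = S (fun w => F w + G w) by rewrite /S big_split.
have E1 : S (fun w => tri w.2) = S (fun w => tri w.1.1.1.1).
  rewrite /S (sym (fun w => let: (i, j, p, q, r) := w in (r, j, p, q, i))).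
    by apply: eq_bigr => -[[[[i j] p] q] r].
  by move=> [[[[i j] p] q] r]; rewrite /box5 /P /quad /= !mem_boxes => ? ?; split=> //; lia.
have E2 : S (fun w => tri w.2) = S (fun w => tri w.1.1.1.2).
  rewrite /S (sym (fun w => let: (i, j, p, q, r) := w in (i, r, p, q, j))).
    by apply: eq_bigr => -[[[[i j] p] q] r].
  by move=> [[[[i j] p] q] r]; rewrite /box5 /P /quad /= !mem_boxes => ? ?; split=> //; lia.
have E3 : S (fun w => tri w.2) = S (fun w => tri w.1.1.2).
  rewrite /S (sym (fun w => let: (i, j, p, q, r) := w in (i, j, r, q, p))).
    by apply: eq_bigr => -[[[[i j] p] q] r].
  by move=> [[[[i j] p] q] r]; rewrite /box5 /P /quad /= !mem_boxes => ? ?; split=> //; lia.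
have E4 : S (fun w => tri w.2) = S (fun w => tri w.1.2).
  rewrite /S (sym (fun w => let: (i, j, p, q, r) := w in (i, j, p, r, q))).
    by apply: eq_bigr => -[[[[i j] p] q] r].
  by move=> [[[[i j] p] q] r]; rewrite /box5 /P /quad /= !mem_boxes => ? ?; split=> //; lia.
have E5 : S (fun w => k - 5 * tri w.2) + S (fun w => tri w.2) + S (fun w => tri w.2)
   + S (fun w => tri w.2) + S (fun w => tri w.2) + S (fun w => tri w.2) =
   S (fun w => tri w.1.1.1.1) + S (fun w => tri w.1.1.1.2) +
   S (fun w => tri w.1.1.2) + S (fun w => tri w.1.2) + S (fun w => tri w.2).
  rewrite !SD /S; apply: eq_bigr => -[[[[i j] p] q] r].
  by rewrite /P /quad /=; lia.
by rewrite E; lia.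
Qed.

(** In [zagier_sum0] with [M = 8 k + 5], [x] is odd, and up to sign [x = 4 i + 1]. Then
    [d e = 2 (k - tri i) + 1] and [d e - x^2 = 2 (k - 5 tri i)]. *)
Lemma sigma_rec L k : 0 <= k -> 8 * k + 5 <= L ->
  (\sum_(i <- box L)
     (k - 5 * tri i)%Z * sigmaZ L (2 * (k - tri i) + 1)%Z = 0)%R.
Proof.
move=> k0 kL; pose M := 8 * k + 5; have EM : M = 8 * k + 5 by [].
have M_mod8 : M mod 8 = 5 by rewrite /M; lia.
pose F (v : Z * Z * Z) := let: (d, e, x) := v in (d * e - x * x) * d.
pose Q (v : Z * Z * Z) := v.2 mod 4 =? 1.
have S0 : (\sum_(v <- box3 L | uset M v) F v = 0)%R by exact: zagier_sum0 kL M_mod8.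
have S1 : (\sum_(v <- box3 L | uset M v && ~~ Q v) F v =
           \sum_(v <- box3 L | uset M v && Q v) F v)%R.
  pose f (v : Z * Z * Z) := let: (d, e, x) := v in (d, e, - x).
  rewrite (reindex_seq (P := fun v => uset M v && Q v) (f := f) (g := f) _
    (box3_uniq L) (box3_uniq L)).
  - by apply: eq_bigr => -[[d e] x] _; rewrite /F /f; lia.
  - move=> [[d e] x] _ /andP[/usetP[d0 e0 h]]; rewrite /Q /= => hx.
    have Uf : uset M (d, e, - x) by apply/usetP; split; lia.
    by split; [exact: uset_box Uf|apply/andP; split=> //; lia|congr (_, _, _); lia].
  - move=> [[d e] x] _ /andP[/usetP[d0 e0 h]]; rewrite /Q /= => hx.
    have Uf : uset M (d, e, - x) by apply/usetP; split; lia.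
    have xodd : x mod 2 = 1.
      have : oddZ (x * x) by rewrite /oddZ; lia.
      by move=> /oddZ_mul/andP[]; rewrite /oddZ; lia.
    by split; [exact: uset_box Uf|apply/andP; split=> //; lia|congr (_, _, _); lia].
pose W (w : Z * Z * Z) := factors (2 * (k - tri w.2) + 1) w.1.
have S2 : (\sum_(v <- box3 L | uset M v && Q v) F v =
  \sum_(w <- box3 L | W w) (2 * ((k - 5 * tri w.2) * w.1.1))%Z)%R.
  pose f (v : Z * Z * Z) := let: (d, e, x) := v in (d, e, 4 * x + 1).
  pose g (v : Z * Z * Z) := let: (d, e, x) := v in (d, e, x / 4).
  rewrite (reindex_seq (P := W) (f := f) (g := g) _ (box3_uniq L) (box3_uniq L)).
  - apply: eq_bigr => -[[d e] x]; rewrite /W /= => /and3P[d0 e0 /Z.eqb_spec h].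
    by rewrite /F /f (_ : d * e = 2 * (k - tri x) + 1) // /tri; lia.
  - move=> [[d e] x] _; rewrite /W /= => /and3P[d0 e0 /Z.eqb_spec h].
    have Uf : uset M (d, e, 4 * x + 1).
      by apply/usetP; move: h; rewrite /tri /M => h; split; lia.
    split; [exact: uset_box Uf|apply/andP; split=> //; rewrite /Q /=; lia|].
    by congr (_, _, _); lia.
  - move=> [[d e] x] xL /andP[/usetP[d0 e0 h]]; rewrite /Q /= => hx.
    have Ex : x = 4 * (x / 4) + 1 by lia.
    move: xL; rewrite !mem_boxes; move: (x / 4) Ex h => y -> h ?; split.
    + by lia.
    + by apply/and3P; split; rewrite /= ?/tri; lia.
    + by congr (_, _, _); lia.
have S3 : (\sum_(w <- box3 L | W w) (2 * ((k - 5 * tri w.2) * w.1.1))%Z =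
  2%Z * \sum_(i <- box L)
     (k - 5 * tri i)%Z * sigmaZ L (2 * (k - tri i) + 1)%Z)%R.
  rewrite [LHS]big_mkcond [LHS]big_allpairs_dep exchange_big big_distrr /=.
  apply: eq_bigr => i _; rewrite -big_mkcond /= /sigmaZ !big_distrr /=.
  by apply: eq_bigr => v _.
move: S0; rewrite (bigID Q) /= S1 S2 S3.
by set S := (\sum_(_ <- _) _)%R; lia.
Qed.

Lemma sigmaZ_le0 L m : m <= 0 -> sigmaZ L m = 0.
Proof.
move=> m0; rewrite /sigmaZ big1 // => -[d e] /and3P[d0 e0 /Z.eqb_spec h]; nia.
Qed.

Lemma sigmaZ1 L : 1 <= L -> sigmaZ L 1 = 1.
Proof.
move=> L1; rewrite /sigmaZ (reindex_seq (s := [:: (1, 1)]) (P := predT)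
  (f := id) (g := id) _ _ (box2_uniq L)) ?big_seq1 //.
  by move=> [d e]; rewrite inE => /eqP-> _ /=; rewrite !mem_boxes; split=> //; lia.
move=> [d e] _ /and3P[d0 e0 /Z.eqb_spec h].
by have [-> ->] : d = 1 /\ e = 1 by nia.
Qed.

Lemma Zcard_quad_lt0 L k : k < 0 -> Zcard (box4 L) (quad k) = 0.
Proof.
move=> k0; rewrite /Zcard big1 // => -[[[i j] p] q] /(quad_inbox (Z.le_refl k)).
by rewrite /=; lia.
Qed.

Lemma Zcard_quad0 L : 0 <= L -> Zcard (box4 L) (quad 0) = 1.
Proof.
move=> L0; rewrite (Zcard_bij (s := [:: (0, 0, 0, 0)]) (P := predT)
  (f := id) (g := id) _ (box4_uniq L)) //.
- by rewrite /Zcard big_seq1.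
- by move=> v; rewrite inE => /eqP-> _; rewrite !mem_boxes; split=> //; lia.
- move=> [[[i j] p] q] _ /(quad_inbox (Z.le_refl 0)) /= h.
  by have [-> -> -> ->] : [/\ i = 0, j = 0, p = 0 & q = 0] by split; lia.
Qed.

(* Jacobi's four-square theorem for odd squares, as (4 i + 1)^2 = 8 tri i + 1. *)
Lemma Zcard_quad_sigma L k : 8 * k + 5 <= L -> 5 <= L ->
  Zcard (box4 L) (quad k) = sigmaZ L (2 * k + 1).
Proof.
move=> kL L5; pose D k := Zcard (box4 L) (quad k) - sigmaZ L (2 * k + 1).
suff : D k = 0 by rewrite /D; lia.
(* The bound [(L - 5) / 8] is the largest argument at which [sigma_rec] is available. *)
apply: (@shift_rec_eq0 L ((L - 5) / 8) tri (fun k i => k - 5 * tri i)) => //.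
- by lia.
- exact: tri_gt0.
- by move=> j j0; rewrite /D Zcard_quad_lt0 ?sigmaZ_le0; lia.
(* The leading coefficient is [j] itself, so only the initial values at 0 need comparing. *)
- move=> j _; rewrite /tri => j0; have -> : j = 0 by lia.
  by rewrite /D Zcard_quad0 ?sigmaZ1; lia.
- move=> j jL.
  rewrite -[RHS](subrr 0%R) -[X in (_ = X - _)%R](quad_rec L j).
  rewrite -[X in (_ = _ - X)%R](@sigma_rec L j ltac:(lia) ltac:(lia)) -sumrB.
  by apply: eq_bigr => i _; rewrite /D; lia.
- by lia.
Qed.

(** * Ternary forms *)

(** For [m = 2 k + 1] this is counted by [T k], and [rep3 k] by [R k]. *)
Definition cone3 m (v : Z * Z * Z) := let: (x, y, z) := v in
  [&& 0 <? x, 0 <? y, 0 <=? z & m =? x * (y + z) + 2 * y * z].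

Definition rep3 k (v : Z * Z * Z) := let: (i, j, l) := v in
  tri i + tri j + 2 * tri l =? k.

Definition rep4 k (v : Z * Z * Z * Z) := let: (i, j, l, f) := v in
  tri i + tri j + 2 * tri l + f * f =? k.

Lemma rep4_inbox L k v : k <= L -> rep4 k v -> inbox L v.
Proof.
move: v => [[[i j] l] f] kL; rewrite /rep4 /inbox.
have := @tri_ge i; have := @tri_ge j; have := @tri_ge l; have := @abs_le_sqr f.
lia.
Qed.

(** With [n = p + q], [tri p + tri q = (p - q)^2 + n (n + 1)], and [n (n + 1) = 2 tri l] for
    [n = 2 l] as well as for [n = - 2 l - 1]. *)
Lemma quad_rep4 L k : k <= L ->
  Zcard (box4 L) (quad k) = Zcard (box4 L) (rep4 k).
Proof.
move=> kL.
pose f (v : Z * Z * Z * Z) := let: (i, j, p, q) := v in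
  (i, j, if (p + q) mod 2 =? 0 then (p + q) / 2 else - (p + q + 1) / 2, p - q).
pose g (v : Z * Z * Z * Z) := let: (i, j, l, f) := v in
  if f mod 2 =? 0 then (i, j, l + f / 2, l - f / 2)
  else (i, j, (f - 2 * l - 1) / 2, (- f - 2 * l - 1) / 2).
apply: (Zcard_box4 (f := f) (g := g)).
- by move=> v; apply: quad_inbox.
- by move=> v; apply: rep4_inbox.
- move=> [[[i j] p] q]; rewrite /quad /f /rep4 => /Z.eqb_spec h; case: ifP => par.
    have [s Es] : exists s, p = 2 * s - q by exists ((p + q) / 2); lia.
    rewrite Es in par h *; rewrite (_ : (_ + _) / 2 = s); last by lia.
    split; first by apply/Z.eqb_spec; move: h; rewrite /tri; lia.
    by rewrite /g ifT; [congr (_, _, _, _); lia | lia].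
  have [s Es] : exists s, p = 2 * s + 1 - q by exists ((p + q) / 2); lia.
  rewrite Es in par h *; rewrite (_ : _ / 2 = - s - 1); last by lia.
  split; first by apply/Z.eqb_spec; move: h; rewrite /tri; lia.
  by rewrite /g ifF; [congr (_, _, _, _); lia | lia].
- move=> [[[i j] l] y]; rewrite /rep4 /g => /Z.eqb_spec h; case: ifP => par.
    have [s Es] : exists s, y = 2 * s by exists (y / 2); lia.
    rewrite Es in par h *; rewrite (_ : _ / 2 = s); last by lia.
    split; first by apply/Z.eqb_spec; move: h; rewrite /tri; lia.
    by rewrite /f ifT; [congr (_, _, _, _); lia | lia].
  have [s Es] : exists s, y = 2 * s + 1 by exists (y / 2); lia.
  rewrite Es in par h *; rewrite (_ : _ / 2 = s - l); last by lia.
  rewrite (_ : _ / 2 = - s - l - 1); last by lia.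
  split; first by apply/Z.eqb_spec; move: h; rewrite /tri; lia.
  by rewrite /f ifF; [congr (_, _, _, _); lia | lia].
Qed.

(** Slicing [rep4] and [cone] by their last coordinate [f] gives [rep3] and [cone3] at [k - f^2];
    the totals agree, so the difference obeys a recurrence with leading coefficient 1. *)
Lemma rep3_cone3 L k : 8 * k + 5 <= L -> 5 <= L ->
  Zcard (box3 L) (rep3 k) = Zcard (box3 L) (cone3 (2 * k + 1)).
Proof.
move=> kL L5.
pose D k := Zcard (box3 L) (rep3 k) - Zcard (box3 L) (cone3 (2 * k + 1)).
suff : D k = 0 by rewrite /D; lia.
apply: (@shift_rec_eq0 L ((L - 5) / 8) (fun i => i * i) (fun _ _ => 1)) => //.
- by lia.
- by nia.
- move=> j j0; rewrite /D /Zcard !big1 // => -[[x y] z].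
    by move=> /and4P[? ? ? /Z.eqb_spec h]; nia.
  rewrite /rep3; have := @tri_ge x; have := @tri_ge y; have := @tri_ge z; lia.
- move=> j jL.
  have E : Zcard (box4 L) (rep4 j) = Zcard (box4 L) (cone (2 * j + 1)).
    rewrite -quad_rep4; last by lia.
    have oj : oddZ (2 * j + 1) by rewrite /oddZ; lia.
    by rewrite (@cone_diag L) -?sigmaZ_diag ?Zcard_quad_sigma //; lia.
  move: E; rewrite [LHS]Zcard_pairs [RHS]Zcard_pairs => /eqP.
  rewrite -subr_eq0 -sumrB => /eqP E; rewrite -[RHS]E.
  apply: eq_bigr => i _; rewrite mul1r /D; congr (_ - _)%R.
    by apply: eq_Zcard => -[[x y] z]; rewrite /rep3 /rep4; lia.
  apply: eq_Zcard => -[[x y] z]; rewrite /cone3 /cone; congr [&& _, _, _ & _]; lia.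
- by lia.
Qed.

Lemma rep3_exists k : 0 <= k ->
  exists i j l, tri i + tri j + 2 * tri l = k.
Proof.
move=> k0; pose L := 8 * k + 5.
have /hasP[[[i j] l] _ /Z.eqb_spec E] : has (rep3 k) (box3 L); last by exists i, j, l.
apply/negPn/negP => no.
have := @rep3_cone3 L k ltac:(lia) ltac:(lia).
rewrite {1}/Zcard big_hasC // => /esym.
have mem : (2 * k + 1, 1, 0) \in box3 L by rewrite !mem_boxes; lia.
rewrite /Zcard big_mkcond (bigD1_seq _ mem (box3_uniq L)) /= ifT; last by lia.
set S := (\sum_(_ <- _ | _) _)%R; have : 0 <= S; last by lia.
rewrite /S; apply: (big_ind (fun x => 0 <= x)) => [//|x y ? ?|v _]; first by lia.
by case: ifP.
Qed.

(* [(4 i + 1)^2 + (4 j + 1)^2 + 2 (4 l + 1)^2 = 4 (2 k + 1)] *)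
Lemma three_squares k : 0 <= k -> exists a b c,
  2 * (2 * k + 1) =
  (2 * a + 1) * (2 * a + 1) + (2 * b + 1) * (2 * b + 1) + 4 * c * c.
Proof.
move=> /rep3_exists[i [j [l E]]].
(* The identity [u^2 + v^2 = 2 ((u + v) / 2)^2 + 2 ((u - v) / 2)^2] at [u = 4 i + 1], [v = 4 j + 1]
   allows halving. *)
by exists (i + j), (2 * l), (i - j); rewrite -E /tri; lia.
Qed.

(** * From three squares to the two forms *)

Lemma sign_mod3 a : exists b, [/\ b = a \/ b = - a, b * b = a * a &
  exists u, b = 3 * u \/ b = 3 * u + 1].
Proof.
have [h|h] : a mod 3 = 2 \/ a mod 3 <> 2 by lia.
  by exists (- a); split; [right|lia|exists (- (a / 3) - 1); lia].
by exists a; split; [left|lia|exists (a / 3); lia].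
Qed.

(* Choosing signs such that [a], [b], [c] agree mod 3 puts the vector
   [(a, b, c)] of norm [6 (2 n + 1)] in the lattice spanned by the orthogonal
   vectors [(1, 1, -2)], [2 (1, 1, 1)] and [3 (1, -1, 0)]. *)
Lemma odd_form_123 n : 0 <= n ->
  exists x y z, 2 * n + 1 = x * x + 2 * y * y + 3 * z * z.
Proof.
(* The argument [3 * n + 1] makes the left-hand side [6 (2 n + 1)]. *)
move=> n0; have [a0 [b0 [c0 E0]]] := @three_squares (3 * n + 1) ltac:(lia).
have [a [sa Ea [u ma]]] := sign_mod3 (2 * a0 + 1).
have [b [sb Eb [v mb]]] := sign_mod3 (2 * b0 + 1).
have [c [sc Ec [w mc]]] := sign_mod3 (2 * c0).
have E : 6 * (2 * n + 1) = a * a + b * b + c * c by lia.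
(* Squares are 0 or 1 mod 3, so a sum of three of them divisible by 3 has all terms 0 or all terms
   1; the residues 0 and 1 chosen for [a], [b], [c] then coincide. *)
have [mab mac] : (a - b) mod 3 = 0 /\ (a - c) mod 3 = 0.
  by move: E {E0 Ea Eb Ec sa sb sc n0}; case: ma => ->; case: mb => ->;
    case: mc => ->; lia.
have {sa sb sc ma mb mc}[pab pc] : (a - b) mod 2 = 0 /\ c mod 2 = 0.
  by clear - sa sb sc; lia.
have {E0 Ea Eb Ec n0 a0 b0 c0 u v w} {}E := E.
have [z Ez] : exists z, a - b = 6 * z by exists ((a - b) / 6); clear E; lia.
have [y Ey] : exists y, a + b + c = 6 * y by exists ((a + b + c) / 6); clear E; lia.
have [x Ex] : exists x, c = 2 * (y - x) by exists (y - c / 2); clear E; lia.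
exists x, y, z; have Ha : a = x + 2 * y + 3 * z by clear E; lia.
have Hb : b = x + 2 * y - 3 * z by clear E; lia.
by rewrite Ha Hb Ex in E; lia.
Qed.

Theorem theorem1p2 : universal 14 7 1 3 14 /\ universal 14 7 2 3 7.
Proof.
split=> n; have [u [w [v E]]] := @odd_form_123 (Z.of_nat n) ltac:(lia).
  (* As [7 = 2^2 + 3 * 1^2], composition gives [7 (u^2 + 3 v^2) = (2 u + 3 v)^2 + 3 (u - 2 v)^2]. *)
  by exists (2 * u + 3 * v), (u - 2 * v), w; lia.
(* Here [7 (2 w^2 + 3 v^2) = 2 (w + 3 v)^2 + 3 (2 w - v)^2]. *)
by exists (w + 3 * v), (2 * w - v), u; lia.
Qed.
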